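(* Let $n\ge 2$ and $s\ge 1$ be integers, and let $q=\lfloor s/n\rfloor$ and $r=s-qn$ be the quotient and remainder when $s$ is divided by $n$. Then \[ f(n,s)\ge\begin{cases} \dfrac{s(n-1)}{2} & \text{if } r=0,\\[2mm] \dfrac{s(n-1)}{2}-\dfrac{n-r}{2} & \text{otherwise.}\end{cases} \]
   Context: Let $N=\{1,\dots,n\}$ be a set of $n\ge 2$ agents and $M$ a finite set of indivisible goods. Each agent $i$ has an additive utility function $u_i:2^M\to\mathbb{R}_{\ge 0}$, i.e., $u_i(M')=\sum_{g\in M'}u_i(\{g\})$. An instance consists of $N$, $M$ and $(u_i)_{i\in N}$. An allocation $\mathcal{A}=(A_1,\dots,A_n)$ is an ordered partition of $M$ into $n$ (possibly empty) bundles, $A_i$ going to agent $i$; it is $s$-balanced if $|A_i|=s$ for all $i\in N$. Agent $i$ is EF1 towards agent $j$ in $\mathcal{A}$ if $A_j=\varnothing$ or there exists $g\in A_j$ with $u_i(A_i)\ge u_i(A_j\setminus\{g\})$. $\mathcal{A}$ is EF1 if every agent is EF1 towards every other agent. An exchange transforms an allocation $\mathcal{A}$ into an allocation $\mathcal{B}$ where, for some distinct $i,j\in N$, $g\in A_i$, $g'\in A_j$, we have $B_i=(A_i\cup\{g'\})\setminus\{g\}$, $B_j=(A_j\cup\{g\})\setminus\{g'\}$, and $B_k=A_k$ for $k\ne i,j$. $f(n,s)$ denotes the smallest integer such that for every instance with $n$ agents and $ns$ goods and every $s$-balanced allocation $\mathcal{A}$ in the instance, some EF1 allocation can be reached from $\mathcal{A}$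 using at most $f(n,s)$ exchanges. *)

(* Defs.v *)
From mathcomp Require Import all_boot all_order all_algebra.
From mathcomp Require Import boolp reals.

Set Implicit Arguments.
Unset Strict Implicit.
Unset Printing Implicit Defensive.

Import Order.TTheory GRing.Theory Num.Theory.

Local Open Scope ring_scope.

Section Allocations.
Variables (n : nat) (M : finType).

Definition bundles := {ffun 'I_n -> {set M}}.

(* An ordered partition; bundles may be empty, so mathcomp's [partition],
   which excludes [set0], is not the right notion. *)
Definition is_allocation (A : bundles) : bool :=
  [forall i, forall j, (i != j) ==> [disjoint A i & A j]]
  && (\bigcup_i A i == [set: M]).

Definition balanced (s : nat) (A : bundles) : bool := [forall i, #|A i| == s].

Definition exchange : rel bundles := fun A B =>
  [exists i : 'I_n, exists j : 'I_n, exists g in A i, exists g' in A j,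
    [&& i != j,
        B i == (A i :|: [set g']) :\ g,
        B j == (A j :|: [set g]) :\ g' &
        [forall k, (k != i) && (k != j) ==> (B k == A k)]]].

End Allocations.

Section Fairness.
Variables (R : realType) (n : nat) (M : finType).

Definition additive_utility (v : {set M} -> R) : Prop :=
  (forall S : {set M}, 0 <= v S) /\
  (forall S : {set M}, v S = \sum_(g in S) v [set g]).

Definition EF1_towards (u : 'I_n -> {set M} -> R) (A : bundles n M)
    (i j : 'I_n) : Prop :=
  A j = set0 \/ exists2 g, g \in A j & u i (A i) >= u i (A j :\ g).

Definition EF1 (u : 'I_n -> {set M} -> R) (A : bundles n M) : Prop :=
  forall i j : 'I_n, i != j -> EF1_towards u A i j.

End Fairness.

(* A path [p] from [A] in the graph of [exchange] lists the successive
   allocations, so [size p] is the number of exchanges performed. *)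
Definition exchanges_suffice (R : realType) (n s k : nat) : Prop :=
  forall (M : finType) (u : 'I_n -> {set M} -> R) (A : bundles n M),
    #|M| = (n * s)%N ->
    (forall i, additive_utility (u i)) ->
    is_allocation A -> balanced s A ->
    exists p : seq (bundles n M),
      [/\ path (@exchange n M) A p, (size p <= k)%N,
          is_allocation (last A p) & EF1 u (last A p)].

(* The minimum defining [f] is attained: round-robin yields a balanced EF1
   allocation, and any two balanced allocations are joined by at most [n * s]
   exchanges. *)
Section Existence.
Variables (R : realType) (n : nat) (M : finType).
Implicit Types A B : bundles n M.

Lemma allocationP A :
  is_allocation A <-> exists o : M -> 'I_n, forall k x, (x \in A k) = (o x == k).
Proof.
split=> [/andP[/forallP disA /eqP covA]|[o oP]].
  have ex x : exists i, x \in A i.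
    have : x \in \bigcup_i A i by rewrite covA inE.
    by case/bigcupP=> i _ xi; exists i.
  have [o oP] := choice ex; exists o => k x.
  apply/idP/eqP => [xk|<-]; last exact: oP.
  apply/eqP/negPn/negP => neq.
  have /forallP/(_ k)/implyP/(_ neq) := disA (o x).
  by move/disjointFr/(_ (oP x)); rewrite xk.
apply/andP; split.
  apply/forallP => i; apply/forallP => j; apply/implyP => neq.
  rewrite -setI_eq0; apply/eqP/setP => x; rewrite !inE !oP.
  by apply/negbTE/negP => /andP[/eqP oi /eqP oj]; rewrite -oi -oj eqxx in neq.
by apply/eqP/setP => x; rewrite inE; apply/bigcupP; exists (o x); rewrite ?oP.
Qed.

Lemma exchange_reach s B : is_allocation B -> balanced s B ->
  forall m A, is_allocation A -> balanced s A ->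
  (\sum_i #|B i :\: A i| <= m)%N ->
  exists p, [/\ path (@exchange n M) A p, (size p <= m)%N & last A p = B].
Proof.
move=> /allocationP[oB oBP] /forallP balB.
have cB i : #|B i| = s by apply/eqP/balB.
elim=> [|m IH] A alA balA leD; have cA i : #|A i| = s by apply/eqP/(forallP balA).
  exists [::]; split=> //=; apply/ffunP => i; apply/esym/eqP.
  rewrite eqEcard cA cB leqnn andbT -setD_eq0 -cards_eq0.
  by move: leD; rewrite leqn0 sum_nat_eq0 => /forallP/(_ i)/implyP/(_ isT).
have [sub|] := boolP [forall i, B i \subset A i].
  exists [::]; split=> //=; apply/ffunP => i; apply/esym/eqP.
  by rewrite eqEcard (forallP sub) cA cB /=.
rewrite negb_forall => /existsP[j /subsetPn[g gB gA]].
have [g' g'A g'B] : exists2 g', g' \in A j & g' \notin B j.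
  apply/subsetPn/negP => sAB.
  have /eqP/setP/(_ g) : A j == B j by rewrite eqEcard sAB cA cB /=.
  by rewrite gB (negbTE gA).
move/allocationP: (alA) => [o oP].
set i := o g.
have gi : g \in A i by rewrite oP.
have ij : i != j by rewrite -oP.
have g'j : o g' = j by apply/eqP; rewrite -oP.
have gg' : g != g' by apply: contraNneq gA => ->.
have g'i : g' \notin A i by rewrite oP g'j eq_sym.
pose C : bundles n M := [ffun k =>
  if k == i then (A i :|: [set g']) :\ g
  else if k == j then (A j :|: [set g]) :\ g' else A k].
have Ci : C i = (A i :|: [set g']) :\ g by rewrite ffunE eqxx.
have Cj : C j = (A j :|: [set g]) :\ g' by rewrite ffunE eq_sym (negbTE ij) eqxx.
have Ck k : k != i -> k != j -> C k = A k by rewrite ffunE => /negbTE-> /negbTE->.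
have AC : exchange A C.
  apply/existsP; exists i; apply/existsP; exists j.
  apply/existsP; exists g; rewrite gi; apply/existsP; exists g'; rewrite g'A /=.
  rewrite ij Ci Cj !eqxx /=; apply/forallP => k; apply/implyP => /andP[ki kj].
  by rewrite Ck.
have alC : is_allocation C.
  apply/allocationP; exists (fun x => if x == g then j else if x == g' then i else o x).
  move=> k x; have [->|ki] := eqVneq k i.
    rewrite Ci !inE oP; have [->|xg] /= := eqVneq x g; first by rewrite eq_sym (negbTE ij).
    by have [->|xg'] /= := eqVneq x g'; rewrite ?eqxx ?orbT ?orbF.
  have [->|kj] := eqVneq k j.
    rewrite Cj !inE oP; have [->|xg] /= := eqVneq x g.
      by rewrite gg' orbT eqxx.
    by have [->|xg'] /= := eqVneq x g'; rewrite ?(negbTE ij) ?orbF.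
  rewrite Ck // oP; have [->|xg] /= := eqVneq x g.
    by rewrite -/i eq_sym (negbTE ki) eq_sym (negbTE kj).
  have [->|//] := eqVneq x g'.
  by rewrite g'j eq_sym (negbTE kj) eq_sym (negbTE ki).
have cU (X : {set M}) x y : x \in X -> y \notin X -> #|(X :|: [set y]) :\ x| = #|X|.
  move=> xX yX; have := cardsD1 x (X :|: [set y]).
  by rewrite setUC !inE xX orbT cardsU1 yX => -[].
have balC : balanced s C.
  apply/forallP => k; have [->|ki] := eqVneq k i; first by rewrite Ci cU ?cA.
  by have [->|kj] := eqVneq k j; [rewrite Cj cU ?cA | rewrite Ck ?cA].
have gBi : g \notin B i.
  by move: gB; rewrite !oBP => /eqP ->; rewrite eq_sym.
have ltD : (\sum_k #|B k :\: C k| < \sum_k #|B k :\: A k|)%N.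
  rewrite (bigD1 j) //= [ltnRHS](bigD1 j) //= -addSn; apply: leq_add.
    rewrite (cardsD1 g (B j :\: A j)) !inE gB gA /= add1n ltnS subset_leq_card //.
    apply/subsetP => x; rewrite Cj !inE.
    have [->|xg'] := eqVneq x g'; first by rewrite (negbTE g'B) /= ?andbF.
    by case: (x == g); rewrite ?orbT ?orbF.
  apply: leq_sum => k kj; have [->|ki] := eqVneq k i; last by rewrite Ck.
  apply: subset_leq_card; apply/subsetP => x; rewrite Ci !inE.
  have [->|xg] := eqVneq x g; first by rewrite (negbTE gBi) andbF.
  by rewrite /= negb_or => /andP[/andP[-> _] ->].
have [|p [pp sp lp]] := IH C alC balC; first by rewrite -ltnS (leq_trans ltD).
by exists (C :: p); split=> //=; rewrite AC.
Qed.

Lemma greedy (m : nat) : forall (v : nat -> M -> R) (S : {set M}), #|S| = m ->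
  exists p : seq M, [/\ uniq p, size p = m, p =i S &
    forall x0 a b, (a <= b)%N -> (b < m)%N -> v a (nth x0 p b) <= v a (nth x0 p a)].
Proof.
elim: m => [|m IH] v S cS.
  exists [::]; split=> // x; first by move/eqP: cS; rewrite cards_eq0 => /eqP->; rewrite inE.
have /card_gt0P[y yS] : (0 < #|S|)%N by rewrite cS.
have [g gS gmax] : exists2 g, g \in S & forall x, x \in S -> v 0%N x <= v 0%N g.
  by case: (Order.TotalTheory.arg_maxP (v 0%N) yS) => g gS gmax; exists g.
have [|p [up sp pS pv]] := IH (fun a => v a.+1) (S :\ g).
  by apply/eqP; rewrite -eqSS -cS (cardsD1 g S) gS.
exists (g :: p); split=> /=.
- by rewrite up pS !inE eqxx.
- by rewrite sp.
- by move=> x; rewrite inE pS !inE; case: eqVneq => [->|].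
- move=> x0 [|a] [|b] //= ab bm; last exact: pv.
  by apply: gmax; have := mem_nth x0 (s := p) (n := b); rewrite sp => /(_ bm); rewrite pS !inE => /andP[].
Qed.

Lemma round_robin s (u : 'I_n -> {set M} -> R) :
  #|M| = (n * s)%N -> (0 < #|M|)%N -> (forall i, additive_utility (u i)) ->
  exists B, [/\ is_allocation B, balanced s B & EF1 u B].
Proof.
move=> cM M0 addu; have /card_gt0P[x0 _] := M0.
have n0 : (0 < n)%N by move: M0; rewrite cM muln_gt0 => /andP[].
pose w (i : 'I_n) g := u i [set g].
pose md k : 'I_n := Ordinal (ltn_pmod k n0).
have [|p [up sp pS pv]] := @greedy (n * s) (fun a => w (md a)) [set: M].
  by rewrite cardsT.
pose h (i : 'I_n) (t : 'I_s) := nth x0 p (t * n + i)%N.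
have lt (i : 'I_n) t : (t < s)%N -> (t * n + i < n * s)%N.
  move=> ts; apply: (@leq_trans (t.+1 * n)); last by rewrite mulnC leq_mul2l ts orbT.
  by rewrite mulSn addnC ltn_add2r.
have mdE (i : 'I_n) t : md (t * n + i)%N = i.
  by apply/val_inj; rewrite /= modnMDl modn_small.
have hinj i : injective (h i).
  move=> t t' /eqP; rewrite nth_uniq ?sp ?lt // eqn_add2r eqn_mul2r.
  by rewrite (gtn_eqF n0) /= => /eqP/val_inj.
pose B : bundles n M := [ffun i => [set h i t | t : 'I_s]].
exists B; split.
- apply/allocationP; exists (fun x => md (index x p)) => i x.
  rewrite ffunE; have xp : (index x p < n * s)%N by rewrite -sp index_mem pS inE.
  apply/imsetP/eqP => [[t _ ->]|<-].
    by rewrite index_uniq ?sp ?lt.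
  have ts : (index x p %/ n < s)%N by rewrite ltn_divLR // mulnC.
  exists (Ordinal ts) => //; rewrite /h /= -divn_eq nth_index // pS inE //.
- by apply/forallP => i; rewrite ffunE card_imset ?card_ord.
move=> i j _; case: (posnP s) => [s0|s0].
  by move: M0; rewrite cM s0 muln0.
right; exists (h j (Ordinal s0)); first by rewrite ffunE imset_f.
have [u0 uS] := addu i.
have -> : B j :\ h j (Ordinal s0) = [set h j t | t in [set~ Ordinal s0]].
  rewrite ffunE; apply/setP => x; rewrite !inE; apply/andP/imsetP.
    by case=> nx /imsetP[t _ ext]; exists t => //; rewrite !inE; apply: contra_neq nx => <-.
  case=> t; rewrite !inE => t0 ->; split; last by rewrite imset_f.
  by rewrite (inj_eq (@hinj j)).
rewrite uS [leRHS]uS ffunE !big_imset /=; try by move=> ? ? _ _ /hinj.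
under eq_bigl do rewrite !inE.
case: s s0 {cM up pS sp} pv @h lt hinj @B => // s s0 pv h lt hinj B.
have -> : Ordinal s0 = ord0 by apply/val_inj.
rewrite (eq_bigl (fun t : 'I_s.+1 => t != ord0)) // big_mkcond big_ord_recl eqxx /= add0r.
rewrite [leRHS]big_ord_recr /= -[leLHS]addr0; apply: lerD; last exact: u0.
apply: ler_sum => t _; rewrite [X in X <= _]/=.
have := pv x0 (t * n + i)%N (t.+1 * n + j)%N; rewrite mdE /w /h /=; apply.
  by rewrite mulSn -addnA addnCA leq_add2l (leq_trans (ltnW (ltn_ord i))) ?leq_addr.
by apply: (lt j t.+1); rewrite ltnS.
Qed.

End Existence.

Lemma exchanges_suffice_exists (R : realType) n s :
  exists k, `[< exchanges_suffice R n s k >].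
Proof.
exists (n * s)%N; apply/asboolP => M u A cM addu alA balA.
have [M0|M0] := posnP #|M|.
  have AE i : A i = set0.
    apply/eqP; rewrite -cards_eq0 -leqn0; apply: (leq_trans (max_card _)).
    by rewrite M0.
  by exists [::]; split=> // i j _; left; apply: AE.
have [B [alB balB efB]] := round_robin cM M0 addu.
have [|p [pp sp lp]] := exchange_reach alB balB (m := n * s) alA balA.
  apply: (@leq_trans (\sum_(i < n) s)); last by rewrite sum_nat_const card_ord.
  apply: leq_sum => i _; rewrite -[leqRHS](eqP (forallP balB i)).
  exact/subset_leq_card/subsetDl.
by exists p; rewrite lp.
Qed.

Definition f (R : realType) (n s : nat) : nat :=
  ex_minn (exchanges_suffice_exists R n s).

Lemma f_spec (R : realType) n s :
  exchanges_suffice R n s (f R n s) /\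
  (forall k, exchanges_suffice R n s k -> (f R n s <= k)%N).
Proof.
rewrite /f; case: ex_minnP => m /asboolP mP mmin; split=> // k /asboolP; exact: mmin.
Qed.

(* Main.v *)
Require Import Defs.
From mathcomp Require Import all_boot all_order all_algebra.
From mathcomp Require Import reals.
From mathcomp Require Import zify lra.

Import Order.TTheory GRing.Theory Num.Theory.

Local Open Scope ring_scope.

Set Implicit Arguments.
Unset Strict Implicit.
Unset Printing Implicit Defensive.

(** Start from [A] and let agent [j] value at 1 each good outside [A j] and at
    0 each good of [A j].  Exchanges keep all bundles at size [s], so [j] being
    EF1 towards [k] in [B] means [#|A j :&: B j| <= #|A j :&: B k| + 1]; summing
    over [k] shows that [j] keeps at most [ceil (s / n)] of its goods.  An
    exchange moves only two goods, and all but [n * ceil (s / n)] of the [n * s]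
    goods have to move. *)

Section Exchanges.
Variables (n : nat) (M : finType).
Implicit Types A B C : bundles n M.

(** Disjointness of the two bundles gives [g != g'], so the deletion can be done before the
    insertion. In this order it is visible that [B i] still contains all of [A i] but [g]. *)
Lemma exchangeP A B : is_allocation A -> exchange A B ->
  exists i j g g', [/\ i != j, g \in A i, g' \in A j &
    [/\ B i = g' |: A i :\ g, B j = g |: A j :\ g' &
        forall k, k != i -> k != j -> B k = A k]].
Proof.
move=> /allocationP[o oP] /existsP[i /existsP[j /existsP[g /andP[gi]]]].
case/existsP=> g' /andP[gj /and4P[ij /eqP Bi /eqP Bj /forallP Bk]].
have gg' : g != g'.
  by apply: contraNneq ij => E; move: gi gj; rewrite E !oP => /eqP-> ->.
exists i, j, g, g'; split=> //; split.
- rewrite Bi; apply/setP=> x; rewrite !inE.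
  by have [->|] := eqVneq x g; rewrite ?(negbTE gg') ?orbF // orbC.
- rewrite Bj; apply/setP=> x; rewrite !inE.
  by have [->|] := eqVneq x g'; rewrite 1?eq_sym ?(negbTE gg') ?orbF // orbC.
- by move=> k ki kj; apply/eqP; apply: (implyP (Bk k)); rewrite ki.
Qed.

Lemma exchange_allocation A B :
  is_allocation A -> exchange A B -> is_allocation B.
Proof.
move=> alA /(exchangeP alA)[i [j [g [g' [ij gi gj [Bi Bj Bk]]]]]].
have /allocationP[o oP] := alA; move: gi gj; rewrite !oP => /eqP gi /eqP gj.
apply/allocationP.
(* The new owner function swaps the owners of [g] and [g']. *)
exists (fun x => if x == g then j else if x == g' then i else o x) => k x.
have gg' : g != g' by apply: contraNneq ij => E; rewrite -gi -gj E.
have [->|ki] := eqVneq k i.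
  rewrite Bi !inE oP; have [->|xg] /= := eqVneq x g.
    by rewrite (negbTE gg') eq_sym (negbTE ij).
  by have [->|] := eqVneq x g'; rewrite ?eqxx.
have [->|kj] := eqVneq k j.
  rewrite Bj !inE oP; have [->|xg] /= := eqVneq x g; first by rewrite eqxx.
  by have [->|] := eqVneq x g'; rewrite ?(negbTE ij).
rewrite Bk // oP; have [->|xg] /= := eqVneq x g.
  by rewrite gi ![_ == k]eq_sym (negbTE ki) (negbTE kj).
by have [->|//] := eqVneq x g'; rewrite gj ![_ == k]eq_sym (negbTE ki) (negbTE kj).
Qed.

(** The incoming good has another owner, so it is new to the bundle and makes up for the outgoing
    one. *)
Lemma exchange_balanced s A B :
  is_allocation A -> exchange A B -> balanced s A -> balanced s B.
Proof.
move=> alA /(exchangeP alA)[i [j [g [g' [ij gi gj [Bi Bj Bk]]]]]].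
have /allocationP[o oP] := alA => /forallP balA; apply/forallP=> k.
have cardU1D1 (X : {set M}) x y : x \in X -> y \notin X -> #|y |: X :\ x| = #|X|.
  by move=> xX yX; rewrite cardsU1 !inE (negbTE yX) andbF [RHS](cardsD1 x) xX.
move: (gi) (gj); rewrite !oP => /eqP ogi /eqP ogj.
have [->|ki] := eqVneq k i.
  by rewrite Bi cardU1D1 // oP ogj eq_sym.
have [->|kj] := eqVneq k j; first by rewrite Bj cardU1D1 // oP ogi.
by rewrite Bk.
Qed.

(** Only agents [i] and [j] lose a good, one each, so the sum drops by at most 2. Here [A] is a
    fixed reference, unrelated to the exchange. *)
Lemma exchange_kept A B C : is_allocation B -> exchange B C ->
  (\sum_i #|A i :&: B i| <= \sum_i #|A i :&: C i| + 2)%N.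
Proof.
move=> alB /(exchangeP alB)[i [j [g [g' [ij _ _ [Ci Cj Ck]]]]]].
have keep1 (X Y Z : {set M}) x : Y :\ x \subset Z ->
    (#|X :&: Y| <= #|X :&: Z| + 1)%N.
  move=> YZ; rewrite (cardsD1 x) addnC leq_add ?leq_b1 // subset_leq_card //.
  by rewrite -setIDA setIS.
rewrite (bigD1 i) // (bigD1 j) 1?eq_sym //= [in leqRHS](bigD1 i) //=.
rewrite [in leqRHS](bigD1 j) 1?eq_sym //=.
have Di : (#|A i :&: B i| <= #|A i :&: C i| + 1)%N.
  by apply: (keep1 _ _ _ g); rewrite Ci subsetUr.
have Dj : (#|A j :&: B j| <= #|A j :&: C j| + 1)%N.
  by apply: (keep1 _ _ _ g'); rewrite Cj subsetUr.
rewrite [in leqRHS](eq_bigr (fun k => #|A k :&: B k|)); last first.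
  by move=> k /andP[ki kj]; rewrite Ck.
have regroup a b c d e :
  (a <= c + 1 -> b <= d + 1 -> a + (b + e) <= c + (d + e) + 2)%N by lia.
exact: regroup.
Qed.

(** Induction moves the start [B] while the reference [A] stays fixed; the application takes
    [B = A], where the left sum is [n * s]. *)
Lemma path_exchange s A B p :
  is_allocation B -> balanced s B -> path (@exchange n M) B p ->
  balanced s (last B p) /\
  (\sum_i #|A i :&: B i| <= \sum_i #|A i :&: last B p i| + 2 * size p)%N.
Proof.
elim: p B => [|C p IH] B alB balB /=; first by rewrite muln0 addn0.
case/andP=> BC /IH[||balp leC]; first exact: exchange_allocation BC.
  exact: exchange_balanced BC balB.
split=> //; apply: leq_trans (exchange_kept A alB BC) _.
by rewrite mulnS (addnC 2%N) addnA leq_add2r.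
Qed.

Lemma card_allocation A (X : {set M}) :
  is_allocation A -> (\sum_i #|X :&: A i| = #|X|)%N.
Proof.
case/allocationP=> o oP; rewrite -sum1_card (partition_big o predT) //=.
apply: eq_bigr => i _; rewrite -sum1_card.
by apply: eq_bigl => x; rewrite inE oP.
Qed.

End Exchanges.

Section OutsideUtility.
Variables (R : realType) (M : finType).

Definition outside_utility (X S : {set M}) : R := #|S :\: X|%:R.

Lemma outside_utility_additive X : additive_utility (outside_utility X).
Proof.
split=> [S|S]; first exact: ler0n.
rewrite /outside_utility -natr_sum -sum1_card; congr _%:R.
rewrite big_mkcond [RHS]big_mkcond; apply: eq_bigr => x _ /=.
rewrite inE; case: (x \in S); rewrite ?andbF // andbT.
have [xX|xX] := boolP (x \in X) => /=.
  by apply/esym/eqP; rewrite cards_eq0 setD_eq0 sub1set.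
by rewrite (setDidPl _) ?cards1 // disjoints1.
Qed.

(** By balance, [j] values [B k] at [s - #|A j :&: B k|], so EF1 reads
    [#|A j :&: B j| <= #|A j :&: B k| + 1]. The sum over [k] has slack [n.-1] and not [n], since
    [k = j] gives an equality. *)
Lemma EF1_outside_kept n s (A B : bundles n M) :
    is_allocation B -> balanced s B ->
    EF1 (fun i => outside_utility (A i)) B ->
  forall j, (n * #|A j :&: B j| <= #|A j| + n.-1)%N.
Proof.
move=> alB /forallP balB ef j; rewrite -(card_allocation (A j) alB).
have -> : (n * #|A j :&: B j| = \sum_(k < n) #|A j :&: B j|)%N.
  by rewrite sum_nat_const card_ord.
rewrite (bigD1 j) // [in leqRHS](bigD1 j) //= -addnA leq_add2l.
have -> : n.-1 = (\sum_(k < n | k != j) 1)%N.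
  by rewrite sum1_card cardC1 card_ord.
rewrite -big_split /=; apply: leq_sum => k kj.
have cB i : #|B i| = s by apply/eqP.
have cI i : (#|A j :&: B i| + #|B i :\: A j| = s)%N by rewrite setIC cardsID cB.
have [Bk0|[g gB]] := ef j k ltac:(by rewrite eq_sym).
  (* An empty bundle forces [s = 0], so [j] keeps nothing. *)
  by have := cI j; have := cB k; rewrite Bk0 cards0; lia.
rewrite /outside_utility ler_nat => le.
(* Every good is worth at most 1 to [j], so removing [g] costs at most 1. *)
have : (#|B k :\: A j| <= #|(B k :\ g) :\: A j| + 1)%N.
  rewrite (cardsD1 g) addnC leq_add ?leq_b1 // subset_leq_card //.
  by apply/subsetP=> x; rewrite !inE => /and3P[-> -> ->].
have := cI j; have := cI k; lia.
Qed.

End OutsideUtility.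

(** The quotient is the ceiling of [s / n], the most that one agent can keep. The instance has goods
    [(i, t)], with [(i, t)] initially held by agent [i]. *)
Lemma exchanges_suffice_lower_bound (R : realType) n s k :
  exchanges_suffice R n s k -> (n * s <= n * ((s + n.-1) %/ n) + 2 * k)%N.
Proof.
move=> suff_k; pose A : bundles n ('I_n * 'I_s)%type := [ffun i => setX [set i] setT].
have cA i : #|A i| = s by rewrite ffunE cardsX cards1 mul1n cardsT card_ord.
have alA : is_allocation A.
  by apply/allocationP; exists fst => i x; rewrite ffunE !inE andbT.
have balA : balanced s A by apply/forallP=> i; rewrite cA.
have [||p [pp sp alp efp]] := suff_k _ (fun i => outside_utility R (A i)) A _ _ alA balA.
- by rewrite card_prod !card_ord.
- by move=> i; apply: outside_utility_additive.
have [balp] := path_exchange A alA balA pp.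
under eq_bigr do rewrite setIid cA.
rewrite sum_nat_const card_ord => /leq_trans; apply; apply: leq_add; last by rewrite leq_mul2l.
rewrite -[X in (_ <= X * _)%N]card_ord -sum_nat_const; apply: leq_sum => i _.
(* Positivity of [n] comes from the existence of the agent [i]. *)
rewrite leq_divRL ?(leq_ltn_trans _ (ltn_ord i)) //.
by rewrite mulnC; have := EF1_outside_kept alp balp efp i; rewrite cA.
Qed.

Theorem theorem5p2 (R : realType) (n s : nat) (hn : (2 <= n)%N) (hs : (1 <= s)%N) :
  let q := (s %/ n)%N in
  let r := (s - q * n)%N in
  (f R n s)%:R >=
    (if r == 0%N then s%:R * (n%:R - 1) / 2
     else s%:R * (n%:R - 1) / 2 - (n%:R - r%:R) / 2) :> R.
Proof.
cbv zeta; set q := (s %/ n)%N; set r := (s - q * n)%N; have n0 : (0 < n)%N by lia.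
have := exchanges_suffice_lower_bound (proj1 (f_spec R n s)).
have sE : s = (q * n + r)%N by rewrite subnKC // leq_trunc_div.
have rn : (r < n)%N.
  by rewrite /r {1}(divn_eq s n) addKn ltn_pmod.
(* The boolean, read as 0 or 1, is the rounding up that separates the two cases of the bound. *)
have -> : ((s + n.-1) %/ n = q + (r != 0))%N.
  rewrite sE -addnA divnMDl //; congr addn; case: (posnP r) => [->|r0].
    by rewrite add0n divn_small // prednK.
  have -> : (r + n.-1 = 1 * n + r.-1)%N by lia.
  by rewrite divnMDl // divn_small //; lia.
(* Substituting [q * n = s - r] turns the kept total [n * (q + (r != 0))] into [s] if [r = 0] and
   into [s + (n - r)] otherwise. *)
rewrite -(ler_nat R) !(natrM, natrD); have := congr1 (fun m => m%:R : R) sE.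
rewrite natrD natrM; case: eqP => [->|_] /= sER; lra.
Qed.
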